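(* Let $R$ be a totally ordered commutative ring with $1$ and let $S$ be a Specker $R$-algebra. Then there is a unique partial order $\le$ on $S$ for which $(S,\le)$ is an $f$-algebra over $R$.
   Context: All algebras are commutative and unital. For a commutative $R$-algebra $S$, $\mathrm{Id}(S)$ is the set of idempotents of $S$, a Boolean algebra under $e\vee f=e+f-ef$, $e\wedge f=ef$, $\lnot e=1-e$. A nonzero idempotent $e\in S$ is faithful if for each $a\in R$, $ae=0$ implies $a=0$. A faithful generating algebra of idempotents of $S$ is a Boolean subalgebra $B$ of $\mathrm{Id}(S)$ that generates $S$ as an $R$-algebra and all of whose nonzero elements are faithful. $S$ is a Specker $R$-algebra if it is a commutative $R$-algebra that has a faithful generating algebra of idempotents. A ring $A$ with a partial order $\le$ is an $\ell$-ring if (i) $(A,\le)$ is a lattice, (ii) $a\le b$ implies $a+c\le b+c$ for each $c$, (iii) $0\le a,b$ implies $0\le ab$. An $\ell$-ring is totally ordered if its order is total, and is an $f$-ring if it is a subdirect product of totally ordered rings; equivalently, if $a\wedge b=0$ and $c\ge0$ imply $ac\wedge b=0$. For $R$ totally ordered, a partially ordered $R$-algebra $S$ is an $\ell$-algebra over $R$ if it is an $\ell$-ring and an $R$-algebra such that $0\le s\in S$ and $0\le a\in R$ imply $as\ge0$; it is an $f$-algebra over $R$ if it is both an $\ell$-algebra over $R$ and an $f$-ring. *)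

(* Defs.v *)
From HB Require Import structures.
From mathcomp Require Import all_boot all_order all_algebra.

Set Implicit Arguments.
Unset Strict Implicit.
Unset Printing Implicit Defensive.

Import GRing.Theory.
Local Open Scope ring_scope.

(* Subsets and orders are boolean ({pred _}, rel _), as usual in MathComp;
   under the classical axioms of mathcomp.classical.boolp this is no
   restriction. *)

(* A commutative R-algebra is a commutative ring S with its structure map
   phi : R -> S (for A : comAlgType R this is in_alg A).  MathComp's comAlgType
   is not used because it extends comNzRingType and so excludes S = 0. *)
Definition alg_scale (R S : comPzRingType) (phi : {rmorphism R -> S})
    (a : R) (s : S) : S := phi a * s.

Definition idempotent_elt (S : pzRingType) (e : S) : Prop := e * e = e.

Definition idem_join (S : pzRingType) (e f : S) : S := e + f - e * f.
Definition idem_meet (S : pzRingType) (e f : S) : S := e * f.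
Definition idem_compl (S : pzRingType) (e : S) : S := 1 - e.

Definition idem_subalgebra (S : comPzRingType) (B : {pred S}) : Prop :=
  [/\ {in B, forall e, idempotent_elt e},
      0 \in B /\ 1 \in B,
      {in B &, forall e f, idem_join e f \in B},
      {in B &, forall e f, idem_meet e f \in B}
    & {in B, forall e, idem_compl e \in B}].

Definition subalgebra (R S : comPzRingType) (phi : {rmorphism R -> S})
    (A : {pred S}) : Prop :=
  [/\ 1 \in A,
      forall a, {in A &, forall u v, alg_scale phi a u + v \in A}
    & GRing.mulr_2closed A].

Definition generates (R S : comPzRingType) (phi : {rmorphism R -> S})
    (B : {pred S}) : Prop :=
  forall A : {pred S}, subalgebra phi A -> {subset B <= A} ->
    forall s : S, s \in A.

Definition faithful_idem (R S : comPzRingType) (phi : {rmorphism R -> S})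
    (e : S) : Prop :=
  [/\ idempotent_elt e, e != 0 & forall a : R, alg_scale phi a e = 0 -> a = 0].

Definition faithful_generating (R S : comPzRingType) (phi : {rmorphism R -> S})
    (B : {pred S}) : Prop :=
  [/\ idem_subalgebra B, generates phi B
    & {in B, forall e, e != 0 -> faithful_idem phi e}].

Definition specker (R S : comPzRingType) (phi : {rmorphism R -> S}) : Prop :=
  exists B : {pred S}, faithful_generating phi B.

Definition partial_order (T : Type) (le : rel T) : Prop :=
  [/\ reflexive le, antisymmetric le & transitive le].

Definition is_meet (T : Type) (le : rel T) (x y m : T) : Prop :=
  [/\ le m x, le m y & forall z, le z x -> le z y -> le z m].

Definition is_join (T : Type) (le : rel T) (x y j : T) : Prop :=
  [/\ le x j, le y j & forall z, le x z -> le y z -> le j z].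

Definition lattice_order (T : Type) (le : rel T) : Prop :=
  partial_order le /\
  forall x y, (exists m, is_meet le x y m) /\ (exists j, is_join le x y j).

Definition l_ring (A : pzRingType) (le : rel A) : Prop :=
  [/\ lattice_order le,
      forall a b c, le a b -> le (a + c) (b + c)
    & forall a b, le 0 a -> le 0 b -> le 0 (a * b)].

Definition totally_ordered_ring (A : pzRingType) (le : rel A) : Prop :=
  l_ring le /\ total le.

(* The family p embeds A in the product of the T i as a subring and a
   sublattice; joint injectivity of p follows from the third condition and the
   antisymmetry of le. *)
Definition subdirect_of_totally_ordered (A : pzRingType) (le : rel A) : Prop :=
  exists (I : Type) (T : I -> pzRingType) (leT : forall i, rel (T i))
         (p : forall i, {rmorphism A -> T i}),
  [/\ forall i, totally_ordered_ring (leT i),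
      forall i (t : T i), exists x, p i x = t,
      forall x y, le x y <-> (forall i, leT i (p i x) (p i y)),
      forall x y m, is_meet le x y m ->
        forall i, is_meet (leT i) (p i x) (p i y) (p i m)
    & forall x y j, is_join le x y j ->
        forall i, is_join (leT i) (p i x) (p i y) (p i j)].

Definition f_ring (A : pzRingType) (le : rel A) : Prop :=
  l_ring le /\ subdirect_of_totally_ordered le.

Definition l_algebra (R S : comPzRingType) (phi : {rmorphism R -> S})
    (leR : rel R) (leS : rel S) : Prop :=
  l_ring leS /\ forall (a : R) (s : S), leR 0 a -> leS 0 s -> leS 0 (alg_scale phi a s).

Definition f_algebra (R S : comPzRingType) (phi : {rmorphism R -> S})
    (leR : rel R) (leS : rel S) : Prop :=
  l_algebra phi leR leS /\ f_ring leS.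

(* Main.v *)
(** Let [B] be a faithful generating Boolean algebra of idempotents of [S].
    For each ultrafilter [U] of [B] and [s : S] there is exactly one [a : R]
    such that [s - phi a] is annihilated by some element of [U]: uniqueness is
    faithfulness, and existence holds because the [s] having such an [a] form a
    subalgebra containing [B].  These evaluations [s |-> a] are ring morphisms
    onto [R] that jointly separate the points of [S], and the required order is
    the pointwise one.
    For uniqueness, let [q] be a morphism from [S] onto a totally ordered ring
    that is a factor of an [f]-algebra order.  Idempotents of a totally ordered
    ring are [0] or [1], so, unless [q] is zero, the [e] in [B] with [q e = 1]
    form an ultrafilter [U] and [q] factors through the evaluation at [U]; thus
    pointwise positive elements are positive.  Conversely, if [s] is positive
    and has value [a] at [U], then [phi a * e = s * e] is positive for some [e]
    in [U], which by faithfulness rules out [a < 0]. *)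
Require Import Defs.
From HB Require Import structures.
From mathcomp Require Import all_boot all_order all_algebra.
From mathcomp Require Import ring boolp classical_sets.

Set Implicit Arguments.
Unset Strict Implicit.
Unset Printing Implicit Defensive.

Import GRing.Theory.
Local Open Scope ring_scope.

(** * Translation and sign rules in lattice-ordered rings *)

Section OrderedRing.
Variables (A : pzRingType) (le : rel A).
Hypothesis lA : l_ring le.

Lemma l_ring_refl : reflexive le.
Proof. by case: lA => -[[]]. Qed.

Lemma l_ring_trans : transitive le.
Proof. by case: lA => -[[]]. Qed.

Lemma l_ring_anti : antisymmetric le.
Proof. by case: lA => -[[]]. Qed.

Lemma l_ring_add2r c a b : le a b -> le (a + c) (b + c).
Proof. by case: lA => _ h _; apply: h. Qed.

Lemma l_ring_mul_ge0 a b : le 0 a -> le 0 b -> le 0 (a * b).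
Proof. by case: lA => _ _; apply. Qed.

Lemma l_ring_sub_ge0 a b : le 0 (b - a) = le a b.
Proof.
apply/idP/idP => [/(l_ring_add2r a)|/(l_ring_add2r (- a))].
  by rewrite add0r subrK.
by rewrite subrr.
Qed.

Lemma l_ring_oppr_ge0 a : le 0 (- a) = le a 0.
Proof. by rewrite -[RHS]l_ring_sub_ge0 sub0r. Qed.

End OrderedRing.

(** * Squares and idempotents in totally ordered rings *)

Section TotallyOrderedRing.
Variables (A : pzRingType) (le : rel A).
Hypothesis tA : totally_ordered_ring le.

Let lA : l_ring le := proj1 tA.

Lemma total_sqr_ge0 a : le 0 (a * a).
Proof.
have /orP[a0|a0] := proj2 tA 0 a; first exact: (l_ring_mul_ge0 lA).
by rewrite -mulrNN; apply: (l_ring_mul_ge0 lA); rewrite (l_ring_oppr_ge0 lA).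
Qed.

(** The smaller of [e] and [1 - e], say [f], satisfies [0 <= f * (1 - f - f) = - f], while
    [f = f * f] is nonnegative; so [f = 0]. *)
Lemma total_idem_eq01 (e : A) : e * e = e -> e = 0 \/ e = 1.
Proof.
have small (f : A) : f * f = f -> le f (1 - f) -> f = 0.
  move=> ff h; apply: (l_ring_anti lA); have f0 : le 0 f.
    by rewrite -ff total_sqr_ge0.
  rewrite f0 andbT -(l_ring_oppr_ge0 lA).
  have: le 0 (f * (1 - f - f)).
    by apply: (l_ring_mul_ge0 lA) => //; rewrite (l_ring_sub_ge0 lA).
  by rewrite !mulrBr mulr1 ff subrr sub0r.
move=> ee; have /orP[|h] := proj2 tA e (1 - e); first by left; apply: small.
right; apply/esym/subr0_eq/small; last by rewrite subKr.
by rewrite mulrBl mul1r mulrBr mulr1 ee subrr subr0.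
Qed.

End TotallyOrderedRing.

(** * Ultrafilters of the Boolean algebra, by Zorn *)

Section Ultrafilters.
Variables (S : comPzRingType) (B : {pred S}).
Hypothesis BA : idem_subalgebra B.

Record ultrafilter := Ultrafilter {
  uset :> S -> Prop;
  ultra_sub : forall e, uset e -> e \in B;
  ultra1 : uset 1;
  ultra0 : ~ uset 0;
  ultraM : forall e f, uset e -> uset f -> uset (e * f);
  ultraC : forall e, e \in B -> uset e \/ uset (1 - e) }.

(* Zorn is applied to the filters avoiding the annihilator of [s], with the
   empty set allowed so that the union of the empty chain qualifies. *)
Lemma ultrafilter_separates s :
  s != 0 -> exists U : ultrafilter, forall e, U e -> s * e <> 0.
Proof.
case: BA => idB [B0 B1] _ mulB complB s0.
pose P : set (set S) := [set F | [/\ forall e, F e -> e \in B,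
  forall e f, F e -> F f -> F (e * f),
  forall e g, F e -> g \in B -> e * g = e -> F g
  & forall e, F e -> s * e <> 0]]%classic.
have [F FP totF|F [[FB FM Fup Fs] Fmax]] := @Zorn_bigcup _ P.
  split.
  - by move=> e [X FX Xe]; have [h _ _ _] := FP X FX; exact: h.
  - move=> e f [X FX Xe] [Y FY Yf].
    have [XY|YX] := totF X Y FX FY.
      by exists Y => //; have [_ h _ _] := FP Y FY; apply: h => //; exact: XY.
    by exists X => //; have [_ h _ _] := FP X FX; apply: h => //; exact: YX.
  - move=> e g [X FX Xe] gB eg; exists X => //.
    by have [_ _ h _] := FP X FX; exact: h eg.
  - by move=> e [X FX Xe]; have [_ _ _ h] := FP X FX; exact: h.
have F1 : F 1.
  apply: contrapT => nF1; have noF e : ~ F e.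
    by move=> Fe; apply: nF1; apply: Fup Fe B1 _; rewrite mulr1.
  (* By upward closure [F] would be empty, hence strictly inside this filter, which avoids the
     annihilator since [s != 0]. *)
  apply: (Fmax [set 1]%classic).
    by split=> [e /noF//|/(_ 1 erefl)].
  split=> [_ ->//|_ _ -> ->|_ g -> _|_ ->]; rewrite ?mulr1 ?mul1r//.
  exact/eqP.
have annih e : e \in B -> ~ F e -> exists2 f, F f & s * (f * e) = 0.
  (* The filter [G] generated by [F] and [e] is strictly larger than [F], so by maximality it meets
     the annihilator of [s]. *)
  move=> eB nFe.
  pose G := [set g | g \in B /\ exists2 f, F f & f * e * g = f * e]%classic.
  apply: contrapT => nann; apply: (Fmax G).
    split=> [g Fg|/(_ e) GF].
      by split; [exact: FB | exists g => //; rewrite mulrAC idB// FB].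
    by apply: nFe; apply: GF; split=> //; exists 1; rewrite ?mul1r ?idB.
  split=> [g []//|g h [gB [f Ff fg]] [hB [k Fk kh]]|
      g h [gB [f Ff fg]] hB gh|g [gB [f Ff fg]] sg].
  - split; first exact: mulB.
    exists (f * k); first exact: FM.
    transitivity (f * e * g * (k * e * h)); last by rewrite fg kh mulrACA idB.
    by rewrite -{1}(idB e eB); ring.
  - by split=> //; exists f => //; rewrite -fg -mulrA gh.
  - by apply: nann; exists f => //; rewrite -fg mulrCA sg mulr0.
have FC e : e \in B -> F e \/ F (1 - e).
  move=> eB; apply: contrapT => /not_orP[ne nce].
  (* Since [e + (1 - e) = 1], the two annihilation relations add up to [s * (f * g) = 0]. *)
  have [f Ff sf] := annih e eB ne.
  have [g Fg sg] := annih (1 - e) (complB e eB) nce.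
  apply: (Fs (f * g)); first exact: FM.
  transitivity (g * (s * (f * e)) + f * (s * (g * (1 - e)))); first by ring.
  by rewrite sf sg !mulr0 addr0.
have F0 : ~ F 0 by move=> /Fs; rewrite mulr0.
by exists (Ultrafilter FB F1 F0 FM FC).
Qed.

End Ultrafilters.

(** * Evaluation of [S] at an ultrafilter *)

Section Evaluation.
Variables (R S : comPzRingType) (phi : {rmorphism R -> S}) (B : {pred S}).
Hypothesis SB : faithful_generating phi B.

Let BA : idem_subalgebra B.
Proof. by case: SB. Qed.

Let faithB (U : ultrafilter B) a e : U e -> phi a * e = 0 -> a = 0.
Proof.
case: SB => _ _ fB Ue; have [|_ _] := fB e (ultra_sub Ue); last exact.
by apply/eqP => e0; apply: (@ultra0 _ _ U); rewrite -e0.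
Qed.

Lemma specker_ind (P : S -> Prop) :
  P 1 -> (forall a u v, P u -> P v -> P (phi a * u + v)) ->
  (forall u v, P u -> P v -> P (u * v)) -> {in B, forall e, P e} ->
  forall s, P s.
Proof.
move=> P1 PD PM PB s; case: SB => _ gB _.
pose A : {pred S} := [pred u | `[<P u>]].
apply/asboolP/(gB A); last by move=> e /PB Pe; apply/asboolP.
split; first exact/asboolP.
- by move=> a u v /asboolP Pu /asboolP Pv; apply/asboolP/PD.
- by move=> u v /asboolP Pu /asboolP Pv; apply/asboolP/PM.
Qed.

(** The default [0] is never reached: [eval_at_ann] shows the set inhabited, and faithfulness makes
    its element unique. *)
Definition eval_at (U : ultrafilter B) (s : S) : R :=
  xget 0 [set a | exists2 e, U e & (s - phi a) * e = 0]%classic.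

Section AtUltrafilter.
Variable U : ultrafilter B.

Lemma eval_atE s a e : U e -> (s - phi a) * e = 0 -> eval_at U s = a.
Proof.
move=> Ue sa; apply: xget_unique; first by exists e.
move=> b [f Uf sb]; apply/subr0_eq/(faithB (ultraM Ue Uf)).
transitivity (f * ((s - phi a) * e) - e * ((s - phi b) * f)).
  by rewrite rmorphB; ring.
by rewrite sa sb !mulr0 subr0.
Qed.

Lemma eval_at_ultra e : U e -> eval_at U e = 1.
Proof.
move=> Ue; apply: (eval_atE Ue).
by case: BA => idB _ _ _ _; rewrite rmorph1 mulrBl mul1r idB ?subrr// (ultra_sub Ue).
Qed.

Lemma eval_at_ultraC e : e \in B -> U (1 - e) -> eval_at U e = 0.
Proof.
case: BA => idB _ _ _ _ eB Ue; apply: (eval_atE Ue).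
by rewrite rmorph0 subr0 mulrBr mulr1 idB ?subrr.
Qed.

Lemma eval_at_phi (a : R) : eval_at U (phi a) = a.
Proof. by apply: (eval_atE (ultra1 U)); rewrite subrr mul0r. Qed.

Lemma eval_at_ann s : exists2 e, U e & (s - phi (eval_at U s)) * e = 0.
Proof.
suff [a [e Ue sa]] : exists a, exists2 e, U e & (s - phi a) * e = 0.
  by rewrite (eval_atE Ue sa); exists e.
elim/specker_ind: s => [|a u v [b [e Ue ub]] [c [f Uf vc]]
  |u v [b [e Ue ub]] [c [f Uf vc]]|e eB].
- by exists 1, 1; [exact: ultra1 | rewrite rmorph1 subrr mul0r].
- exists (a * b + c), (e * f); first exact: ultraM.
  transitivity (phi a * f * ((u - phi b) * e) + e * ((v - phi c) * f)).
    by rewrite rmorphD rmorphM; ring.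
  by rewrite ub vc !mulr0 addr0.
- exists (b * c), (e * f); first exact: ultraM.
  transitivity (v * f * ((u - phi b) * e) + phi b * e * ((v - phi c) * f)).
    by rewrite rmorphM; ring.
  by rewrite ub vc !mulr0 addr0.
- have [idB _ _ _ _] := BA; have [Ue|Ue] := ultraC U eB.
    by exists 1, e => //; rewrite rmorph1 mulrBl mul1r idB// subrr.
  by exists 0, (1 - e) => //; rewrite rmorph0 subr0 mulrBr mulr1 idB// subrr.
Qed.

Lemma eval_at_is_zmod_morphism : zmod_morphism (eval_at U).
Proof.
move=> u v; have [e Ue ue] := eval_at_ann u; have [f Uf vf] := eval_at_ann v.
apply: (eval_atE (ultraM Ue Uf)).
transitivity (f * ((u - phi (eval_at U u)) * e)
              - e * ((v - phi (eval_at U v)) * f)).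
  by rewrite rmorphB; ring.
by rewrite ue vf !mulr0 subr0.
Qed.

Lemma eval_at_is_monoid_morphism : monoid_morphism (eval_at U).
Proof.
split=> [|u v]; first exact/eval_at_ultra/ultra1.
have [e Ue ue] := eval_at_ann u; have [f Uf vf] := eval_at_ann v.
apply: (eval_atE (ultraM Ue Uf)).
transitivity (v * f * ((u - phi (eval_at U u)) * e)
              + phi (eval_at U u) * e * ((v - phi (eval_at U v)) * f)).
  by rewrite rmorphM; ring.
by rewrite ue vf !mulr0 addr0.
Qed.

HB.instance Definition _ :=
  GRing.isZmodMorphism.Build S R (eval_at U) eval_at_is_zmod_morphism.
HB.instance Definition _ :=
  GRing.isMonoidMorphism.Build S R (eval_at U) eval_at_is_monoid_morphism.

End AtUltrafilter.

(** If [s - t] were nonzero, some ultrafilter would avoid its annihilator; but its value there is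
    [0], so a member annihilates it. *)
Lemma eval_at_inj s t : (forall U, eval_at U s = eval_at U t) -> s = t.
Proof.
move=> st; apply/subr0_eq/eqP; apply: contrapT => /negP.
move=> /(ultrafilter_separates BA)[U Us].
have [e Ue] := eval_at_ann U (s - t).
by rewrite rmorphB /= st subrr rmorph0 subr0 => /Us; apply.
Qed.

(* Letting [G] take values in [S] rather than [R] is what makes the claim stable
   under the binary operations of [S]. *)
Lemma eval_at_bind u (G : R -> S) :
  exists w, forall U, eval_at U w = eval_at U (G (eval_at U u)).
Proof.
have bind2 (op : R -> R -> R) (x y : S) :
    (forall H : R -> S, exists w, forall U, eval_at U w = eval_at U (H (eval_at U x))) ->
    (forall H : R -> S, exists w, forall U, eval_at U w = eval_at U (H (eval_at U y))) ->
  forall H : R -> S, exists w, forall U,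
    eval_at U w = eval_at U (H (op (eval_at U x) (eval_at U y))).
  (* With the value [a] of [x] frozen, [Py] gives an element [K a]; the map [K] is then bound along
     [x]. *)
  move=> Px Py H; have [K KP] := choice (fun a => Py (H \o op a)).
  by have [w wP] := Px K; exists w => U; rewrite wP KP.
elim/specker_ind: u G => [G|a x y Px Py G|x y Px Py G|e eB G].
- by exists (G 1) => U; rewrite rmorph1.
- have [w wP] := bind2 (fun b c => a * b + c) _ _ Px Py G.
  by exists w => U; rewrite wP rmorphD rmorphM /= eval_at_phi.
- have [w wP] := bind2 *%R _ _ Px Py G.
  by exists w => U; rewrite wP rmorphM.
(* The value of [e] is [1] or [0], so [e] glues the two cases together. *)
- exists (e * G 1 + (1 - e) * G 0) => U; rewrite rmorphD !rmorphM rmorphB rmorph1 /=.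
  have [/eval_at_ultra ->|/(eval_at_ultraC eB) ->] := ultraC U eB.
    by rewrite subrr mul0r mul1r addr0.
  by rewrite subr0 mul0r mul1r add0r.
Qed.

(** Taking for [h] the minimum or maximum of [R] produces the lattice operations of [S]. *)
Lemma eval_at_lift2 (h : R -> R -> R) s t :
  exists w, forall U, eval_at U w = h (eval_at U s) (eval_at U t).
Proof.
have [K KP] := choice (fun a => eval_at_bind t (phi \o h a)).
have [w wP] := eval_at_bind s K.
by exists w => U; rewrite wP KP eval_at_phi.
Qed.

(** * The pointwise order as an f-algebra order *)

Section PointwiseOrder.
Variable leR : rel R.
Hypothesis tR : totally_ordered_ring leR.

Let lR : l_ring leR := proj1 tR.
Let refR := l_ring_refl lR.

Definition eval_le : rel S :=
  fun s t => `[<forall U : ultrafilter B, leR (eval_at U s) (eval_at U t)>].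

Lemma eval_leP s t :
  reflect (forall U, leR (eval_at U s) (eval_at U t)) (eval_le s t).
Proof. exact: asboolP. Qed.

Lemma eval_le_antisym : antisymmetric eval_le.
Proof.
move=> s t /andP[/eval_leP st /eval_leP ts]; apply: eval_at_inj => U.
by apply: (l_ring_anti lR); rewrite st ts.
Qed.

Lemma eval_meet_exists s t : exists2 m, is_meet eval_le s t m &
  forall U, is_meet leR (eval_at U s) (eval_at U t) (eval_at U m).
Proof.
have [m mE] := eval_at_lift2 (fun a b => if leR a b then a else b) s t.
have mP U : is_meet leR (eval_at U s) (eval_at U t) (eval_at U m).
  rewrite mE; case: ifPn => st; split=> //; have := proj2 tR (eval_at U s) (eval_at U t).
  by rewrite (negPf st).
exists m => //; split; try by apply/eval_leP => U; case: (mP U).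
move=> z /eval_leP zs /eval_leP zt; apply/eval_leP => U.
by case: (mP U) => _ _; apply.
Qed.

Lemma eval_join_exists s t : exists2 j, is_join eval_le s t j &
  forall U, is_join leR (eval_at U s) (eval_at U t) (eval_at U j).
Proof.
have [j jE] := eval_at_lift2 (fun a b => if leR a b then b else a) s t.
have jP U : is_join leR (eval_at U s) (eval_at U t) (eval_at U j).
  rewrite jE; case: ifPn => st; split=> //; have := proj2 tR (eval_at U s) (eval_at U t).
  by rewrite (negPf st).
exists j => //; split; try by apply/eval_leP => U; case: (jP U).
move=> z /eval_leP zs /eval_leP zt; apply/eval_leP => U.
by case: (jP U) => _ _; apply.
Qed.

Lemma eval_le_l_ring : l_ring eval_le.
Proof.
split; first split.
- split=> [s||t s u /eval_leP st /eval_leP tu]; first exact/eval_leP.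
    exact: eval_le_antisym.
  by apply/eval_leP => U; apply: (l_ring_trans lR) (tu U).
- move=> s t; split.
    by have [m mP _] := eval_meet_exists s t; exists m.
  by have [j jP _] := eval_join_exists s t; exists j.
- move=> s t u /eval_leP st; apply/eval_leP => U.
  by rewrite !rmorphD; exact: (l_ring_add2r lR _ (st U)).
- move=> s t /eval_leP s0 /eval_leP t0; apply/eval_leP => U.
  rewrite rmorph0 rmorphM; apply: (l_ring_mul_ge0 lR).
    by have := s0 U; rewrite rmorph0.
  by have := t0 U; rewrite rmorph0.
Qed.

Lemma eval_le_f_algebra : f_algebra phi leR eval_le.
Proof.
split; split; try exact: eval_le_l_ring.
- move=> a s a0 /eval_leP s0; apply/eval_leP => U.
  rewrite rmorph0 rmorphM /= eval_at_phi; apply: (l_ring_mul_ge0 lR) => //.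
  by have := s0 U; rewrite rmorph0.
- exists (ultrafilter B), (fun _ => R : pzRingType), (fun _ => leR).
  exists (fun U => eval_at U : {rmorphism S -> R}); split=> //.
  + by move=> U a; exists (phi a); exact: eval_at_phi.
  + by move=> s t; split=> [/eval_leP|?] //; exact/eval_leP.
  + move=> s t m [ms mt mP] U; have [m' [ms' mt' mP'] m'P] := eval_meet_exists s t.
    (* Meets are unique, so an arbitrary meet is the one computed pointwise. *)
    suff -> : m = m' by exact: m'P.
    by apply: eval_le_antisym; rewrite mP' ?mP.
  + move=> s t j [js jt jP] U; have [j' [js' jt' jP'] j'P] := eval_join_exists s t.
    suff -> : j = j' by exact: j'P.
    by apply: eval_le_antisym; rewrite jP' ?jP.
Qed.

(** * Totally ordered images of [S], and uniqueness of the order *)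

Lemma onto_total_eval (T : pzRingType) (leT : rel T) (q : {rmorphism S -> T}) :
  totally_ordered_ring leT ->
  (forall s, q s = 0) \/
  exists U : ultrafilter B, forall s, q s = q (phi (eval_at U s)).
Proof.
move=> tT; case: BA => idB [B0 B1] _ mulB complB.
(* In the zero ring the set [F] below would contain [0], so this case is split off. *)
have [q1|q1] := eqVneq (1 : T) 0.
  by left=> s; rewrite -[q s]mulr1 q1 mulr0.
right; pose F := [set e | e \in B /\ q e = 1]%classic.
have FB e : F e -> e \in B by case.
have F1 : F 1 by split; rewrite ?rmorph1.
have F0 : ~ F 0 by case=> _; rewrite rmorph0 => /esym/eqP; exact/negP.
have FM e f : F e -> F f -> F (e * f).
  by move=> [eB qe] [fB qf]; split; rewrite ?mulB// rmorphM qe qf mulr1.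
have FC e : e \in B -> F e \/ F (1 - e).
  move=> eB; have [|qe|qe] := @total_idem_eq01 T leT tT (q e).
  - by rewrite -rmorphM idB.
  - by right; split; rewrite ?complB// rmorphB rmorph1 qe subr0.
  - by left.
exists (Ultrafilter FB F1 F0 FM FC) => s.
have [e [_ qe] /(congr1 q)] := eval_at_ann (Ultrafilter FB F1 F0 FM FC) s.
by rewrite rmorphM qe mulr1 rmorphB rmorph0 => /subr0_eq.
Qed.

Section Uniqueness.
Variable leS : rel S.
Hypothesis fS : f_algebra phi leR leS.

Let lS : l_ring leS.
Proof. by case: fS => -[]. Qed.

Lemma f_algebra_idem_ge0 e : idempotent_elt e -> leS 0 e.
Proof.
case: fS => _ [_ [I [T [leT [q [tT _ qP _ _]]]]]] ee; apply/qP => i.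
by rewrite rmorph0 -ee rmorphM; apply: total_sqr_ge0.
Qed.

Lemma f_algebra_phi_ge0 a : leR 0 a -> leS 0 (phi a).
Proof.
case: fS => -[_ h] _ a0; rewrite -[phi a]mulr1; apply: h => //.
by apply: f_algebra_idem_ge0; exact: mulr1.
Qed.

Lemma f_algebra_ge0E s : leS 0 s = eval_le 0 s.
Proof.
apply/idP/eval_leP => [s0 U|s0].
  rewrite rmorph0; have [e Ue se] := eval_at_ann U s.
  have /orP[//|a0] := proj2 tR 0 (eval_at U s); move: se.
  set a := eval_at U s in a0 * => se.
  suff -> : a = 0 by [].
  have e0 : leS 0 e.
    by apply: f_algebra_idem_ge0; case: BA => idB _ _ _ _; exact/idB/(ultra_sub Ue).
  (* Here [phi a * e = s * e] is nonnegative, and so is its opposite because [a <= 0]. *)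
  apply: (faithB Ue); apply: (l_ring_anti lS).
  have ae : phi a * e = s * e by apply/esym/subr0_eq; rewrite -mulrBl.
  rewrite {2}ae (l_ring_mul_ge0 lS)// andbT.
  rewrite -(l_ring_oppr_ge0 lS) -mulNr -rmorphN (l_ring_mul_ge0 lS)//.
  by apply: f_algebra_phi_ge0; rewrite (l_ring_oppr_ge0 lR).
case: (fS) => _ [_ [I [T [leT [q [tT _ qP _ _]]]]]]; apply/qP => i.
have [q0|[U qU]] := onto_total_eval (q i) (tT i).
  by rewrite !q0; apply: (l_ring_refl (proj1 (tT i))).
rewrite (qU s); have /f_algebra_phi_ge0/qP : leR 0 (eval_at U s); last exact.
by have := s0 U; rewrite rmorph0.
Qed.

(** By translation invariance each order is determined by its nonnegative elements. *)
Lemma f_algebra_leE : eval_le = leS.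
Proof.
apply/funext => s; apply/funext => t.
rewrite -(l_ring_sub_ge0 lS) f_algebra_ge0E.
by rewrite (l_ring_sub_ge0 eval_le_l_ring).
Qed.

End Uniqueness.

End PointwiseOrder.

End Evaluation.

Theorem theorem5p1 (R S : comPzRingType) (phi : {rmorphism R -> S})
    (leR : rel R) (HR : totally_ordered_ring leR) (HS : specker phi) :
  exists! leS : rel S, f_algebra phi leR leS.
Proof.
case: HS => B SB; exists (eval_le phi B leR); split.
  exact: eval_le_f_algebra.
by move=> leS; apply: f_algebra_leE.
Qed.
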